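(* For each prime $p$, there are at least $\binom{p}{2}$ indecomposable and pairwise nonisomorphic metabelian groups of order $p^{60}$ and exponent $p^8$ such that the exponent of the commutator subgroup is $p^3$.
   Context: A group is metabelian if its commutator subgroup is contained in its center. A group is indecomposable if it is nontrivial and not a direct product of two nontrivial subgroups. *)

(* Defs.v *)
From mathcomp Require Import all_boot all_fingroup all_solvable.
Set Implicit Arguments. Unset Strict Implicit. Unset Printing Implicit Defensive.
Local Open Scope group_scope.

(* Paper's definition: a group is metabelian if its commutator subgroup
   is contained in its center. *)
Definition metabelian (gT : finGroupType) (G : {set gT}) : bool :=
  [~: G, G] \subset 'Z(G).

Definition indecomposable (gT : finGroupType) (G : {set gT}) : Prop :=
  G != 1 /\
  ~ (exists H K : {group gT}, [/\ H :!=: 1, K :!=: 1 & H \x K = G]).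

Definition finGrp := {gT : finGroupType & {group gT}}.
Definition grp_of (X : finGrp) : {set (projT1 X)} := gval (projT2 X).

(* Main.v *)
(* The groups are semidirect products of an abelian group [V], a direct sum of
   cyclic groups of orders p^8 (four times), p^7 and p^6 (three times), by a
   cyclic group of order p^3 whose generator b acts on the summands of order
   p^8, p^7, p^6 as the powers 1 + p^5, 1 + p^5 u, 1 + p^5 v, with u and v
   prime to p. The residues of u and v mod p are invariants: commutation with b
   induces on the three layers of [V] the power maps p^5, p^5 u, p^5 v modulo p,
   and any other element with a similar action does so with (1, u, v) rescaled
   by a common factor. This gives (p-1)^2 >= C(p, 2) groups. In a decomposition
   H \x K one factor, say H, contains an element acting as a generator; its
   centralizer is abelian, so K is central, hence inside the Frattini subgroup,
   so H is everything. *)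
Require Import Defs.
From HB Require Import structures.
From mathcomp Require Import all_boot all_fingroup all_solvable.
From mathcomp Require Import all_algebra.
Set Implicit Arguments. Unset Strict Implicit. Unset Printing Implicit Defensive.
Import GRing.Theory.
Local Open Scope group_scope.

(** * Arithmetic modulo prime powers and exponents of sets *)

Lemma Zp_natr_eq0 m n : 1 < m -> (n%:R == 0 :> 'Z_m)%R = (m %| n).
Proof. by move=> m_gt1; rewrite -val_eqE /= val_Zp_nat. Qed.

Lemma Zp_eq_natr m a b : 1 < m -> (a%:R == b%:R :> 'Z_m)%R = (a == b %[mod m]).
Proof. by move=> m_gt1; rewrite -val_eqE /= !val_Zp_nat. Qed.

Lemma Zp_mulrn_eq0 m n (a : 'Z_m) : 1 < m -> m %| n -> (a *+ n = 0)%R.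
Proof.
by move=> m_gt1 mn; rewrite -mulr_natr (eqP (_ : n%:R == 0)%R) ?mulr0 ?Zp_natr_eq0.
Qed.

Lemma val_ZpD m (x y : 'Z_m) : 1 < m -> (x + y)%R = (x + y) %% m :> nat.
Proof. by move=> m_gt1; congr (_ %% _); apply: Zp_cast. Qed.

Lemma Zp_torsion p e s (a : 'Z_(p ^ e)) : prime p -> 0 < e -> s <= e ->
  (a *+ p ^ s = 0 -> exists c : 'Z_(p ^ e), a = c *+ p ^ (e - s))%R.
Proof.
move=> p_pr e_gt0 le_se; rewrite -{1}(natr_Zp a) -mulrnA => /eqP.
have pe_gt1 : 1 < p ^ e by rewrite -{1}(exp1n e) ltn_exp2r // prime_gt1.
rewrite Zp_natr_eq0 // -{1}(subnK le_se) expnD dvdn_pmul2r ?expn_gt0 ?prime_gt0 //.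
by move=> dv; exists (a %/ p ^ (e - s))%:R%R; rewrite -mulrnA divnK ?natr_Zp.
Qed.

(** From [2 * 'C(n, 2) = n * (n - 1)]: at most one factor [p] is lost, and only for [p = 2]. *)
Lemma dvdn_bin2_pfactor p k : prime p -> p ^ k %| 'C(p ^ k.+1, 2).
Proof.
move=> p_pr; have := mul_bin_diag (p ^ k.+1) 1; rewrite bin1 => E.
have: p ^ k.+1 %| 2 * 'C(p ^ k.+1, 2) by rewrite -E dvdn_mulr.
have [-> | p_neq2] := eqVneq p 2; first by rewrite expnS dvdn_pmul2l.
rewrite Gauss_dvdr; first by apply: dvdn_trans; apply: dvdn_exp2l.
rewrite coprimeXl // prime_coprime //.
by apply: contra p_neq2; rewrite dvdn_prime2.
Qed.

Lemma exponent_eq_pfactor (gT : finGroupType) (A : {set gT}) p n x :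
    prime p -> {in A, forall y, y ^+ (p ^ n.+1) = 1} -> x \in A ->
  x ^+ (p ^ n) != 1 -> exponent A = (p ^ n.+1)%N.
Proof.
move=> p_pr /exponentP expA Ax xn1; apply/eqP; rewrite eqn_dvd expA /=.
have /dvdn_pfactor-/(_ p_pr) [k le_kn ox] : #[x] %| p ^ n.+1.
  by apply: dvdn_trans expA; apply: dvdn_exponent.
apply: dvdn_trans (dvdn_exponent Ax); rewrite ox dvdn_exp2l //.
rewrite ltnNge; apply: contra xn1 => le_k.
by rewrite -order_dvdn ox dvdn_exp2l.
Qed.

(** * The isomorphism invariant *)

(* When the abelian normal part is a sum of cyclic groups of orders between
   [p^6] and [p^8], this says that [g] acts by commutation on the summands of
   order [p^t] as [x |-> x ^+ (w * p^5)]: raising to the power [p^(t - 6)] kills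
   the shorter summands, and the factor [y ^+ (p^t)] absorbs the longer ones. *)
Definition commutes_as_power (gT : finGroupType) p t w (g : gT) :=
  forall x, x ^+ (p ^ t) = 1 ->
    exists y, [~ x, g] ^+ (p ^ (t - 6)) = x ^+ (p ^ t.-1 * w) * y ^+ (p ^ t).

(** One [g'], the image of [g], serves all pairs [(t, w)]; this later yields a rescaling factor
    common to all summands. *)
Lemma isog_commutes_as_power (gT rT : finGroupType) p (g : gT) :
  [set: gT] \isog [set: rT] ->
  exists g' : rT, forall t w, commutes_as_power p t w g -> commutes_as_power p t w g'.
Proof.
case/isogP=> f f_inj fG; exists (f g) => t w gP x' x'1.
have /morphimP[x _ _ def_x] : x' \in f @* [set: gT] by rewrite fG inE.
case: (gP x).
  apply: (injmP f_inj); rewrite ?inE // morphX ?inE // -def_x x'1 morph1 //.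
move=> y /(congr1 f); rewrite morphM ?inE // !morphX ?inE // morphR ?inE // -def_x => E.
by exists (f y).
Qed.

(** * Construction of the semidirect product *)

Section PowerAutomorphismExtension.

Variables (p : nat) (I : finType) (e : I -> nat) (l : nat -> nat).

(* The group [V ><| Z/p^3] with [V = prod_i Z/p^(e i)], where the generator of
   [Z/p^3] acts on the [i]-th factor of [V] as multiplication by
   [1 + p^5 * l (e i)]. The carrier does not depend on [l]: the unused argument
   lets the group structure be inferred from the type. *)
Definition ext of prime p & (forall i, 5 < e i <= 8) & (nat -> nat) : Type :=
  ({dffun forall i, 'Z_(p ^ e i)} * 'Z_(p ^ 3))%type.

Hypotheses (p_pr : prime p) (e_bounds : forall i, 5 < e i <= 8).
Notation G := (ext p_pr e_bounds l).

HB.instance Definition _ := Finite.on G.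

Implicit Types x y : G.

Definition twist i := (p ^ 5 * l (e i))%N.

Lemma twist_pexp i s : 4 < s -> (twist i * p ^ (s.+1 - 6) = p ^ s * l (e i))%N.
Proof. by move=> s_gt4; rewrite /twist mulnAC -expnD subSS subnKC. Qed.

Lemma pe_gt1 i : 1 < p ^ e i.
Proof.
by case/andP: (e_bounds i) => h _; rewrite -(exp1n (e i)) ltn_exp2r ?prime_gt1 ?(ltn_trans _ h).
Qed.

Lemma p3_gt1 : 1 < p ^ 3. Proof. by rewrite -(exp1n 3) ltn_exp2r ?prime_gt1. Qed.

Lemma mulrn_pexp i (a : 'Z_(p ^ e i)) k n : e i <= k -> (a *+ (p ^ k * n) = 0)%R.
Proof. by move=> le_ek; rewrite Zp_mulrn_eq0 ?pe_gt1 // dvdn_mulr // dvdn_exp2l. Qed.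

(** Since [e i <= 8 = 3 + 5], the action depends only on the exponent modulo [p ^ 3]. *)
Lemma mulrn_twist0 i (a : 'Z_(p ^ e i)) n : p ^ 3 %| n -> (a *+ (n * twist i) = 0)%R.
Proof.
case/dvdnP=> m ->; rewrite /twist mulnA -(mulnA m) -expnD -mulnA mulnCA.
by apply: mulrn_pexp; case/andP: (e_bounds i).
Qed.

Lemma mulrn_twist_mod i (a : 'Z_(p ^ e i)) n :
  (a *+ (n %% p ^ 3 * twist i) = a *+ (n * twist i))%R.
Proof.
rewrite [in RHS](divn_eq n (p ^ 3)) mulnDl mulrnDr.
by rewrite (mulrn_twist0 _ (dvdn_mull _ (dvdnn _))) add0r.
Qed.

(** Since [e i <= 8 <= 5 + 5], second-order terms vanish. This gives associativity and, later,
    central commutators. *)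
Lemma mulrn_twist2 i (a : 'Z_(p ^ e i)) m n :
  (a *+ (m * twist i) *+ (n * twist i) = 0)%R.
Proof.
rewrite -mulrnA Zp_mulrn_eq0 ?pe_gt1 //.
have /andP[_ le_e8] := e_bounds i.
apply: dvdn_trans (dvdn_exp2l p (leq_trans le_e8 (isT : 8 <= 5 + 5))) _.
by rewrite expnD; apply: dvdn_mul; rewrite dvdn_mull // /twist dvdn_mulr.
Qed.

Lemma ext_eq x y : (forall i, x.1 i = y.1 i) -> x.2 = y.2 -> x = y.
Proof.
by case: x y => [x1 x2] [y1 y2] /= e1 ->; congr (_, _); apply/ffunP.
Qed.

(** [y.2] acts on [x.1 i] as [1 + y.2 * twist i], the [y.2]-th power of [1 + twist i] because
    products of two twists vanish. *)
Definition ext_mul x y : G :=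
  ([ffun i => (x.1 i + y.1 i + x.1 i *+ (y.2 * twist i))%R], (x.2 + y.2)%R).
Definition ext_one : G := ([ffun i => 0%R], 0%R).
Definition ext_inv x : G :=
  ([ffun i => (- x.1 i + x.1 i *+ (x.2 * twist i))%R], (- x.2)%R).

Lemma ext_mul1E x y i :
  ((ext_mul x y).1 i = x.1 i + y.1 i + x.1 i *+ (y.2 * twist i))%R.
Proof. by rewrite ffunE. Qed.

Lemma ext_mul2E x y : (ext_mul x y).2 = (x.2 + y.2)%R. Proof. by []. Qed.

Lemma ext_mulA : associative ext_mul.
Proof.
move=> x y z; apply: ext_eq => [i|]; last by rewrite !ext_mul2E addrA.
rewrite !ext_mul1E ext_mul2E val_ZpD ?p3_gt1 // mulrn_twist_mod.
rewrite !mulrnDl mulrn_twist2 addr0 mulnDl mulrnDr -!addrA; do 2!congr +%R.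
by rewrite [RHS]addrCA; congr +%R; rewrite addrC -addrA.
Qed.

Lemma ext_mul1 : left_id ext_one ext_mul.
Proof.
move=> x; apply: ext_eq => [i|] /=; last exact: add0r.
by rewrite !ffunE mul0rn add0r addr0.
Qed.

Lemma ext_mulV : left_inverse ext_one ext_inv ext_mul.
Proof.
move=> x; apply: ext_eq => [i|] /=; last exact: addNr.
rewrite !ffunE /= mulrnDl mulrn_twist2 addr0 mulNrn.
by rewrite addrAC addrK addNr.
Qed.

HB.instance Definition _ := Finite_isGroup.Build G ext_mulA ext_mul1 ext_mulV.

Lemma mulg1E x y i : ((x * y)%g.1 i = x.1 i + y.1 i + x.1 i *+ (y.2 * twist i))%R.
Proof. exact: ext_mul1E. Qed.

Lemma mulg2E x y : (x * y).2 = (x.2 + y.2)%R. Proof. by []. Qed.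

Lemma oneg1E i : (1 : G).1 i = 0%R. Proof. by rewrite ffunE. Qed.

(** * Powers and commutators *)

Lemma expg2E x n : (x ^+ n).2 = (x.2 *+ n)%R.
Proof. by elim: n => // n IHn; rewrite expgSr mulg2E IHn mulrSr. Qed.

(** The binomial is the sum [0 + 1 + ... + (n - 1)] of the first-order contributions of the
    successive factors. *)
Lemma expg1E x n i :
  ((x ^+ n)%g.1 i = x.1 i *+ n + x.1 i *+ ('C(n, 2) * x.2 * twist i))%R.
Proof.
elim: n => [|n IHn]; first by rewrite oneg1E addr0.
rewrite expgSr mulg1E IHn mulrnDl mulrn_twist2 addr0 -mulrnA mulrSr.
rewrite binS bin1 mulnDl mulnDl mulrnDr mulnA !addrA; congr (_ + _)%R.
by rewrite addrAC.
Qed.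

Lemma expg2E_pfactor x k n : 2 < k -> (x ^+ (p ^ k * n)).2 = 0%R.
Proof.
by move=> k_gt2; rewrite expg2E Zp_mulrn_eq0 ?p3_gt1 // dvdn_mulr // dvdn_exp2l.
Qed.

Lemma expg1E_pfactor x k i : 2 < k -> ((x ^+ (p ^ k.+1))%g.1 i = x.1 i *+ p ^ k.+1)%R.
Proof.
move=> k_gt2; rewrite expg1E mulrn_twist0 ?addr0 // dvdn_mulr //.
by apply: dvdn_trans (dvdn_bin2_pfactor k p_pr); apply: dvdn_exp2l.
Qed.

Lemma expg1E_pfactorM x k n i : 2 < k ->
  ((x ^+ (p ^ k.+1 * n))%g.1 i = x.1 i *+ (p ^ k.+1 * n))%R.
Proof.
move=> k_gt2; rewrite expgM expg1E -[(p ^ k.+1)%N]muln1 expg2E_pfactor 1?ltnW //.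
by rewrite muln0 mul0n addr0 muln1 expg1E_pfactor // -mulrnA.
Qed.

Lemma commg2E x y : [~ x, y].2 = 0%R.
Proof.
by apply: (addrI (y * x).2); rewrite -mulg2E -commgC !mulg2E addr0 addrC.
Qed.

Lemma commg1E x y i :
  ([~ x, y]%g.1 i = x.1 i *+ (y.2 * twist i) - y.1 i *+ (x.2 * twist i))%R.
Proof.
apply: (addrI ((y * x).1 i)); have := mulg1E (y * x) [~ x, y] i.
rewrite commg2E mul0n addr0 -commgC => <-; rewrite !mulg1E.
by rewrite [RHS]addrCA addrK addrC (addrC (y.1 i)).
Qed.

Lemma commg_central x y z : commute [~ x, y] z.
Proof.
apply/commgP/eqP/ext_eq => [i|]; last by rewrite commg2E.
rewrite commg1E commg2E mul0n subr0 oneg1E commg1E mulrnBl.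
by rewrite !mulrn_twist2 subr0.
Qed.

(** * Class, order and exponent of the group *)

Lemma ext_metabelian : metabelian [set: G].
Proof.
rewrite /metabelian gen_subG; apply/subsetP=> _ /imset2P[x y _ _ ->].
by apply/centerP; split=> // z _; apply: commg_central.
Qed.

Lemma card_ext : #|[set: G]| = (p ^ (\sum_i e i + 3))%N.
Proof.
rewrite cardsT card_prod card_dep_ffun foldrE big_map big_enum /=.
have cardZ m : 1 < m -> #|'Z_m| = m by move=> m_gt1; rewrite card_ord Zp_cast.
rewrite cardZ ?p3_gt1 // expnD; congr (_ * _)%N.
rewrite expn_sum; apply: eq_bigr => i _; exact: cardZ (pe_gt1 i).
Qed.

Definition unit_vec i : G := ([ffun j => (j == i)%:R%R], 0%R).
Definition top_elt : G := ([ffun j => 0%R], 1%R).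

Lemma unit_vecE i n : ((unit_vec i).1 i *+ n = n%:R)%R.
Proof. by rewrite ffunE eqxx. Qed.

Lemma top_elt2 : top_elt.2 = 1%N :> nat.
Proof. by rewrite /= modn_small ?Zp_cast ?p3_gt1. Qed.

Lemma commg_top x i : ([~ x, top_elt]%g.1 i = x.1 i *+ twist i)%R.
Proof. by rewrite commg1E top_elt2 mul1n ffunE mul0rn subr0. Qed.

Lemma exponent_ext i : e i = 8 -> exponent [set: G] = (p ^ 8)%N.
Proof.
move=> ei8; apply: (exponent_eq_pfactor (x := unit_vec i)) => // [x _|].
  apply: ext_eq => [j|]; last by rewrite -[(p ^ 8)%N]muln1 expg2E_pfactor.
  have /andP[_ ej8] := e_bounds j.
  by rewrite expg1E_pfactor // oneg1E -[(p ^ 8)%N]muln1 mulrn_pexp.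
apply/eqP=> /(congr1 (fun x : G => x.1 i)).
rewrite expg1E_pfactor // oneg1E unit_vecE => /eqP; rewrite Zp_natr_eq0 ?pe_gt1 // ei8.
by rewrite dvdn_Pexp2l ?prime_gt1.
Qed.

(** * Computation of the invariant *)

Lemma top_commutes_as_power t : 5 < t <= 8 -> commutes_as_power p t (l t) top_elt.
Proof.
case: t => // s /andP[s5 s8] x x1.
have [k s_k k_gt2] : exists2 k, s = k.+1 & 2 < k.
  by case: s s5 {s8 x1} => // k /ltnW; exists k.
have xt i : (x.1 i *+ p ^ s.+1 = 0)%R.
  have := congr1 (fun x : G => x.1 i) x1.
  by rewrite /= expg1E_pfactor ?oneg1E // s_k ltnW.
have /fin_all_exists[c xc] i : exists c : 'Z_(p ^ e i),
  (x.1 i *+ (p ^ s * l (e i)) = x.1 i *+ (p ^ s * l s.+1) + c *+ p ^ s.+1)%R.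
  case: (ltngtP (e i) s.+1) => [lt_es | lt_se | eq_es].
  - by exists 0%R; rewrite mul0rn addr0 !mulrn_pexp.
  - have e_gt0 : 0 < e i by apply: leq_trans lt_se.
    (* On a longer summand [x.1 i] is a multiple of [p ^ (e i - s.+1)], so its multiple by [p ^ s]
       is divisible by [p ^ (e i).-1], hence by [p ^ s.+1]: the discrepancy between [l (e i)] and
       [l s.+1] goes into [y]. *)
    have [c xc] := Zp_torsion p_pr e_gt0 (ltnW lt_se) (xt i).
    pose d := (c *+ p ^ (e i - s.+2))%R.
    have xd n : (x.1 i *+ (p ^ s * n) = d *+ n *+ p ^ s.+1)%R.
      rewrite xc -!mulrnA mulnA -expnD (mulnC n) mulnA -expnD.
      by congr (_ *+ (p ^ _ * n))%R; rewrite -addSnnS -subSn.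
    by exists (d *+ l (e i) - d *+ l s.+1)%R; rewrite !xd mulrnBl addrC subrK.
  - by exists 0%R; rewrite mul0rn addr0 -eq_es.
pose y : G := ([ffun i => c i], 0%R).
exists y; apply: ext_eq => [i|].
  rewrite mulg1E (expg2E y) mul0rn mul0n addr0.
  rewrite expg1E commg2E muln0 mul0n addr0 commg_top -mulrnA twist_pexp // xc.
  by rewrite s_k expg1E_pfactorM // expg1E_pfactor ?ffunE // leqW.
by rewrite mulg2E !expg2E commg2E !mul0rn -expg2E expg2E_pfactor ?addr0 // s_k ltnW.
Qed.

(** Test on the generator of a summand of order [p ^ t]: there the [y] term vanishes, and both sides
    are multiples of [p ^ t.-1] compared modulo [p ^ t]. *)
Lemma commutes_as_power_twist (g : G) t w i : e i = t ->
  commutes_as_power p t w g -> w = l t * g.2 %[mod p].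
Proof.
move=> eit; have /andP[t5 t8] := e_bounds i; rewrite eit in t5 t8.
case: t => // s in eit t5 t8 *.
have [k s_k k_gt2] : exists2 k, s = k.+1 & 2 < k.
  by case: s t5 {t8 eit} => // k /ltnW; exists k.
case/(_ (unit_vec i)).
  apply: ext_eq => [j|]; last by rewrite expg2E mul0rn.
  rewrite oneg1E expg1E_pfactor ?s_k 1?leqW // -s_k ffunE.
  case: eqVneq => [-> | _]; rewrite ?mul0rn //.
  by rewrite -[(p ^ s.+1)%N]muln1 mulrn_pexp ?eit.
move=> y /(congr1 (fun x : G => x.1 i)).
have y2 : (y ^+ (p ^ s.+1) : G).2 = 0%R.
  by rewrite expg2E Zp_mulrn_eq0 ?p3_gt1 // dvdn_exp2l // s_k; apply: leqW; apply: leqW.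
rewrite mulg1E y2 mul0n addr0 s_k expg1E_pfactorM //.
rewrite expg1E_pfactor ?leqW // -s_k -[X in (_ + _ *+ X)%R]muln1 (mulrn_pexp (y.1 i)) ?eit // addr0.
rewrite expg1E commg2E muln0 mul0n addr0 commg1E mul0n subr0 -mulrnA !unit_vecE.
rewrite -mulnA twist_pexp // mulnC -mulnA => /eqP.
rewrite Zp_eq_natr ?pe_gt1 // eit (expnSr p s) -!muln_modr eqn_pmul2l ?expn_gt0 ?prime_gt0 //.
by move/eqP.
Qed.

(** * Derived subgroup, center and indecomposability *)

Hypothesis l_unit : forall t, ~~ (p %| l t).

Lemma dvdn_twist i s m : p ^ (s + 5) %| m * twist i = (p ^ s %| m).
Proof.
rewrite addnC expnD mulnCA dvdn_pmul2l ?expn_gt0 ?prime_gt0 //.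
by rewrite Gauss_dvdl // coprimeXl // prime_coprime.
Qed.

Lemma exponent_der1_ext i : e i = 8 -> exponent [~: [set: G], [set: G]] = (p ^ 3)%N.
Proof.
move=> ei8; have cGG : abelian [~: [set: G], [set: G]].
  apply: subset_trans (centS (subsetT _)).
  exact: subset_trans ext_metabelian (subsetIr _ _).
apply: (exponent_eq_pfactor (x := [~ unit_vec i, top_elt])) => //.
- have: [~: [set: G], [set: G]] \subset Group (group_Ldiv (p ^ 3) cGG).
    rewrite gen_subG; apply/subsetP=> _ /imset2P[x y _ _ ->].
    apply/LdivP; split; first by rewrite mem_commg ?inE.
    apply: ext_eq => [j|]; last by rewrite expg2E commg2E mul0rn.
    rewrite expg1E commg2E muln0 mul0n addr0 oneg1E commg1E mulrnBl.
    by rewrite -!mulrnA !(mulnAC _ (twist j)) !mulrn_twist0 ?subr0 // dvdn_mull.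
  by move/subsetP=> sub x /sub /LdivP[].
- by rewrite mem_commg ?inE.
apply/eqP=> /(congr1 (fun x : G => x.1 i)).
rewrite expg1E commg2E muln0 mul0n addr0 oneg1E commg_top -mulrnA unit_vecE.
by move/eqP; rewrite Zp_natr_eq0 ?pe_gt1 // ei8 mulnC (dvdn_twist i 3) dvdn_Pexp2l ?prime_gt1.
Qed.

(** Commuting with [top_elt] makes every [x.1 i] divisible by [p], as [e i > 5]; commuting with a
    generator of order [p ^ 8] forces [x.2 = 0]. Such an [x] is a [p]-th power. *)
Lemma center_sub_Phi i0 : e i0 = 8 -> 'Z([set: G]) \subset 'Phi([set: G]).
Proof.
move=> ei8; have pG : p.-group [set: G] by rewrite /pgroup card_ext pnatX pnat_id.
apply/subsetP=> x /centerP[_ cx].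
have xb : [~ x, top_elt] = 1 by apply/eqP/commgP; apply: cx; rewrite inE.
have /fin_all_exists[c xc] i : exists c : 'Z_(p ^ e i), x.1 i = (c *+ p)%R.
  have /andP[e5 _] := e_bounds i.
  have e_gt0 : 0 < e i by apply: leq_trans e5.
  have := congr1 (fun x : G => x.1 i) xb; rewrite /= commg_top oneg1E => x0.
  have /Zp_torsion-/(_ p_pr e_gt0 (ltnW e5)) [c ->] : (x.1 i *+ p ^ 5 = 0)%R.
    apply/eqP; move/eqP: x0; rewrite -(natr_Zp (x.1 i)) -!mulrnA.
    rewrite !Zp_natr_eq0 ?pe_gt1 // -{1 3}(subnK (ltnW e5)) dvdn_twist.
    by rewrite expnD dvdn_pmul2r ?expn_gt0 ?prime_gt0.
  by exists (c *+ p ^ (e i - 6))%R; rewrite -mulrnA -expnSr -subSn.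
have x2 : x.2 = 0%R.
  have /commgP/eqP/(congr1 (fun x : G => x.1 i0)) : commute (unit_vec i0) x.
    by apply/commute_sym/cx; rewrite inE.
  rewrite commg1E mul0n subr0 unit_vecE oneg1E => /eqP.
  rewrite Zp_natr_eq0 ?pe_gt1 // ei8 (dvdn_twist i0 3) => dv.
  by apply/eqP; rewrite -(natr_Zp x.2) Zp_natr_eq0 ?p3_gt1.
rewrite (Phi_joing pG) (subsetP (joing_subr _ _)) //.
pose y : G := ([ffun i => c i], 0%R).
suff -> : x = y ^+ (p ^ 1) by rewrite Mho_p_elt ?inE // (mem_p_elt pG) ?inE.
apply: ext_eq => [i|]; last by rewrite expg2E x2 mul0rn.
by rewrite expg1E muln0 mul0n addr0 expn1 xc ffunE.
Qed.

(** The second coordinate is additive and equals 1 on [top_elt], so the two components of [top_elt]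
    cannot both have it divisible by [p]. *)
Lemma dprod_factor_unit (H K : {group G}) : H \x K = [set: G] ->
  exists2 h, h \in H :|: K & ~~ (p %| h.2).
Proof.
case/dprodP=> _ HK _ _; have : top_elt \in H * K by rewrite HK inE.
case/imset2P=> h k Hh Kk /(congr1 (fun x : G => nat_of_ord x.2)).
rewrite top_elt2 mulg2E val_ZpD ?p3_gt1 // => E.
have [ph|] := boolP (p %| h.2); last by exists h; rewrite ?inE ?Hh.
exists k; first by rewrite inE Kk orbT.
apply/negP=> pk; have : p %| (h.2 + k.2) %% p ^ 3.
  by rewrite /dvdn modn_dvdm ?dvdn_exp //; apply: dvdn_add.
by rewrite -E dvdn1 => /eqP p1; move: p_pr; rewrite p1.
Qed.

Lemma commute_of_commute_unit (h x y : G) : ~~ (p %| h.2) ->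
  commute x h -> commute y h -> commute x y.
Proof.
move=> uh /commgP/eqP xh /commgP/eqP yh.
apply/commgP/eqP/ext_eq => [i|]; last by rewrite commg2E.
have := congr1 (fun x : G => x.1 i) xh; have := congr1 (fun x : G => x.1 i) yh.
rewrite /= !commg1E !oneg1E => /subr0_eq yi /subr0_eq xi.
have uZ : (nat_of_ord h.2)%:R%R \is a @GRing.unit 'Z_(p ^ e i).
  by rewrite unitZpE ?pe_gt1 // coprimeXl // prime_coprime.
(* After multiplication by the unit [h.2], the relations [xi] and [yi] replace both terms by
   multiples of [h.1 i] that cancel. *)
apply: (mulIr uZ); rewrite mul0r mulr_natr mulrnBl.
rewrite -!mulrnA !(mulnAC _ (twist i)) (mulnC y.2) (mulnC x.2).
rewrite !(mulnAC _ _ (twist i)) (mulrnA (x.1 i)) (mulrnA (y.1 i)) xi yi.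
by rewrite -!mulrnA !(mulnAC _ (twist i)) (mulnC x.2) subrr.
Qed.

Lemma ext_dprod_factor (H K : {group G}) h i : e i = 8 ->
  H \x K = [set: G] -> h \in H -> ~~ (p %| h.2) -> K :=: 1.
Proof.
move=> ei8 /dprodP[_ HK cHK tiHK] Hh uh; have cKh := subsetP cHK.
have KZ : K \subset 'Z([set: G]).
  apply/subsetP=> x Kx; apply/centerP; split=> [|y _]; first by rewrite inE.
  have: y \in H * K by rewrite HK inE.
  case/imset2P=> h' k Hh' Kk ->.
  apply: commuteM; first by apply: (centP (cKh x Kx)).
  apply: (commute_of_commute_unit uh); first by apply: (centP (cKh x Kx)).
  by apply: (centP (cKh k Kk)).
(* [K] lies in the Frattini subgroup, whose elements are non-generators. *)
have HG : H :=: [set: G].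
  have := @Phi_nongen _ [set: G] H; rewrite genGid; apply; apply/eqP.
  rewrite eqEsubset subsetT -{1}HK mul_subG ?joing_subr //.
  by apply: subset_trans (joing_subl _ _); apply: subset_trans (center_sub_Phi ei8).
by rewrite -tiHK HG setTI.
Qed.

Lemma ext_indecomposable i : e i = 8 -> indecomposable [set: G].
Proof.
move=> ei8; split.
  rewrite -cardG_gt1 card_ext; apply: leq_trans p3_gt1 _.
  by rewrite leq_pexp2l ?prime_gt0 ?leq_addl.
case=> H [K [H1 K1 HK]]; have [h] := dprod_factor_unit HK.
case/setUP=> hHK uh.
  by case/eqP: K1; apply: (ext_dprod_factor ei8 HK hHK uh).
by rewrite dprodC in HK; case/eqP: H1; apply: (ext_dprod_factor ei8 HK hHK uh).
Qed.

End PowerAutomorphismExtension.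

(** * The family and its pairwise nonisomorphism *)

Lemma ext_isog_mod p (I : finType) (e : I -> nat) (l l' : nat -> nat)
    (p_pr : prime p) (e_bounds : forall i, 5 < e i <= 8) :
  [set: ext p_pr e_bounds l] \isog [set: ext p_pr e_bounds l'] ->
  exists k, forall i, l (e i) = l' (e i) * k %[mod p].
Proof.
case/(isog_commutes_as_power p (top_elt l p_pr e_bounds)) => g gP.
exists g.2 => i; apply: commutes_as_power_twist (erefl (e i)) _.
by apply: gP; apply: top_commutes_as_power.
Qed.

(** The sum 57 leaves 3 for the acting cyclic group; 8, 7 and 6 all occur, so three multipliers can
    be compared. *)
Definition factor_exponent (i : 'I_8) := nth 0 [:: 8; 8; 8; 8; 7; 6; 6; 6] i.

Lemma factor_exponent_bounds i : 5 < factor_exponent i <= 8.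
Proof. by case: i; do 8!case=> //. Qed.

Lemma sum_factor_exponent : \sum_i factor_exponent i = 57.
Proof. by rewrite !big_ord_recl big_ord0. Qed.

Definition multiplier u v t := if t == 8 then 1%N else if t == 7 then u else v.

Lemma multiplier_unit p u v t : prime p -> 0 < u < p -> 0 < v < p ->
  ~~ (p %| multiplier u v t).
Proof.
move=> p_pr /andP[u_gt0 ltup] /andP[v_gt0 ltvp].
by rewrite /multiplier; case: ifP => _; [|case: ifP => _]; rewrite gtnNdvd ?prime_gt1.
Qed.

Theorem theorem5 (p : nat) (hp : prime p) :
  exists F : 'I_('C(p, 2)) -> finGrp,
    (forall i : 'I_('C(p, 2)),
        [/\ #|grp_of (F i)| = (p ^ 60)%N,
            exponent (grp_of (F i)) = (p ^ 8)%N,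
            exponent [~: grp_of (F i), grp_of (F i)] = (p ^ 3)%N,
            metabelian (grp_of (F i))
          & indecomposable (grp_of (F i))]) /\
    (forall i j : 'I_('C(p, 2)), i != j -> ~~ (grp_of (F i) \isog grp_of (F j))).
Proof.
have p1_gt0 : 0 < p.-1 by rewrite -ltnS prednK ?prime_gt1 ?prime_gt0.
(* Quotient and remainder by [p.-1] encode [i] as a pair, shifted by one to avoid 0; the quotient
   fits because ['C(p, 2) <= (p - 1) ^ 2]. *)
pose u (i : 'I_('C(p, 2))) := (i %/ p.-1).+1.
pose v (i : 'I_('C(p, 2))) := (i %% p.-1).+1.
have u_bounds i : 0 < u i < p.
  rewrite /= -ltnS -[p]prednK ?prime_gt0 // !ltnS ltn_divLR //.
  apply: leq_trans (ltn_ord i) _; rewrite bin2 leq_half_double.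
  rewrite leqW // -mul2n mulnA leq_mul2r; apply/orP; right.
  by rewrite mul2n -addnn -{1}[p]prednK ?prime_gt0 // -addn1 leq_add2l.
have v_bounds i : 0 < v i < p by rewrite /= -[p in _ < p]prednK ?prime_gt0 // ltnS ltn_mod.
pose l i := multiplier (u i) (v i).
pose X i := ext hp factor_exponent_bounds (l i).
have l_unit i t : ~~ (p %| l i t) by apply: multiplier_unit.
have e8 : factor_exponent ord0 = 8 by [].
exists (fun i => existT (fun gT : finGroupType => {group gT}) (X i : finGroupType) [set: X i]%G).
split=> [i | i j]; rewrite /grp_of /=.
  split; first by rewrite card_ext sum_factor_exponent.
  - exact: exponent_ext e8.
  - exact: exponent_der1_ext e8.
  - exact: ext_metabelian.
  - exact: ext_indecomposable e8.
apply: contra => /ext_isog_mod[k lk].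
(* Summand 0 has order [p ^ 8] and multiplier 1 in both groups, which removes the rescaling. *)
have k1 : k = 1 %[mod p] by have := lk ord0; rewrite /= mul1n => ->.
have {lk}lE t : l i (factor_exponent (inord t)) = l j (factor_exponent (inord t)) %[mod p].
  by rewrite lk -modnMmr k1 modnMmr muln1.
have eq_lt a b : 0 < a < p -> 0 < b < p -> a = b %[mod p] -> a = b.
  by case/andP=> _ ltap /andP[_ ltbp]; rewrite !modn_small.
(* Summand 4 has order [p ^ 7] and detects [u]; summand 5, of order [p ^ 6], detects [v]. *)
have [equ] : u i = u j.
  by apply: eq_lt => //; have := lE 4; rewrite /factor_exponent inordK.
have [eqv] : v i = v j.
  by apply: eq_lt => //; have := lE 5; rewrite /factor_exponent inordK.
by apply/eqP/val_inj; rewrite /= (divn_eq i p.-1) equ eqv -divn_eq.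
Qed.
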